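(* For any lattice $\mathcal{L} \subset \mathbb{R}^n$, any $\mathbf{x} \in \mathbb{R}^n$, and any positive-definite matrices $\Sigma, \Sigma' \in \mathbb{R}^{n \times n}$ satisfying the positive semidefinite inequality $\Sigma' \preceq \Sigma$, \[ f_{\mathcal{L}, \Sigma'}(\mathbf{x}) \leq f_{\mathcal{L}, \Sigma}(\mathbf{x}) . \]
   Context: A lattice $\mathcal{L}\subset\mathbb{R}^n$ is the set of all integer linear combinations of $n$ linearly independent vectors of $\mathbb{R}^n$. Positive-definite matrices are symmetric, and $\Sigma'\preceq\Sigma$ means that $\Sigma-\Sigma'$ is positive semidefinite. For a positive-definite matrix $\Sigma\in\mathbb{R}^{n\times n}$ and $\mathbf{x}\in\mathbb{R}^n$, \[ f_{\mathcal{L}, \Sigma}(\mathbf{x}) = \frac{\sum_{\mathbf{y} \in \mathcal{L}} \exp(-\pi (\mathbf{y} + \mathbf{x})^T \Sigma^{-1} (\mathbf{y} + \mathbf{x}))}{\sum_{\mathbf{y} \in \mathcal{L}} \exp(-\pi \mathbf{y}^T \Sigma^{-1} \mathbf{y})} . \] *)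

(* Defs.v *)
From HB Require Import structures.
From mathcomp Require Import all_boot all_order all_algebra.
From mathcomp Require Import all_classical all_reals all_analysis.

Set Implicit Arguments.
Unset Strict Implicit.
Unset Printing Implicit Defensive.

Import Order.TTheory GRing.Theory Num.Theory.
Local Open Scope classical_set_scope.
Local Open Scope ring_scope.

Definition lattice_of (R : realType) (n : nat) (b : n.-tuple 'cV[R]_n)
    : set 'cV[R]_n :=
  [set v | exists z : 'I_n -> int, v = \sum_(i < n) tnth b i *~ z i].

Definition is_lattice (R : realType) (n : nat) (L : set 'cV[R]_n) : Prop :=
  exists2 b : n.-tuple 'cV[R]_n, free b & L = lattice_of b.

(* [u^T *m A *m u] is a 1 x 1 matrix, read as a scalar at its only entry. *)
Definition quad_form (R : realType) (n : nat) (A : 'M[R]_n) (u : 'cV[R]_n) : R :=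
  (u^T *m A *m u) 0 0.

Definition posdef (R : realType) (n : nat) (A : 'M[R]_n) : Prop :=
  A^T = A /\ forall u : 'cV[R]_n, u != 0 -> 0 < quad_form A u.

Definition possemidef (R : realType) (n : nat) (A : 'M[R]_n) : Prop :=
  A^T = A /\ forall u : 'cV[R]_n, 0 <= quad_form A u.

Definition psd_le (R : realType) (n : nat) (A B : 'M[R]_n) : Prop :=
  possemidef (B - A).

(* The terms are positive, so the unordered sum [esum] in the extended reals is
   the series over L; it is finite when L is a lattice and S is positive
   definite, hence [fine] is only a change of type there. *)
Definition gauss_mass (R : realType) (n : nat) (L : set 'cV[R]_n)
    (S : 'M[R]_n) (x : 'cV[R]_n) : R :=
  fine (\esum_(y in L) (expR (- pi * quad_form (invmx S) (y + x)))%:E).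

Definition periodic_gauss (R : realType) (n : nat) (L : set 'cV[R]_n)
    (S : 'M[R]_n) (x : 'cV[R]_n) : R :=
  gauss_mass L S x / gauss_mass L S 0.

(* Main.v *)
(* Write F_S(x) for the sum over y in L of exp(-pi (y+x)^T S^-1 (y+x)).
   Splitting pairs of lattice points modulo 2L by (u, v) |-> (u + v, u - v)
   gives F_S(x) F_S(t) = sum_c h_c(x+t) h_c(x-t) with c in L/2L, so
   2 ab <= a^2 + b^2 yields 2 F_S(x) F_S(t) <= F_S(0) (F_S(x+t) + F_S(x-t)).
   For v in R^n, F_(S + v v^T)(x) is, up to a factor independent of x, the
   average of F_S(x + s v) against exp(-pi s^2); averaging the inequality over
   t = s v and using the symmetry s |-> -s gives
   F_S(x) F_(S + v v^T)(0) <= F_S(0) F_(S + v v^T)(x).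
   A positive semidefinite difference is a sum of matrices v v^T by Cholesky
   elimination. *)
Require Import Defs.
From HB Require Import structures.
From mathcomp Require Import all_boot all_order all_algebra.
From mathcomp Require Import all_classical all_reals all_analysis.
From mathcomp Require Import measurable_realfun.
From mathcomp Require Import zify ring lra.

Set Implicit Arguments.
Unset Strict Implicit.
Unset Printing Implicit Defensive.

Import Order.TTheory GRing.Theory Num.Theory.
Local Open Scope classical_set_scope.
Local Open Scope ring_scope.

(** * Unordered sums of nonnegative extended reals: scaling, products, integrals *)

Lemma ge0_esumZl (R : realType) (T : choiceType) (k : \bar R)
    (a : T -> \bar R) :
  (0 <= k)%E -> (forall i, (0 <= a i)%E) ->
  (\esum_(i in [set: T]) (k * a i) = k * \esum_(i in [set: T]) a i)%E.
Proof.
(* One inequality suffices: for a finite nonzero factor the converse is [le] applied with the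
   inverse factor to the scaled terms. *)
have le (c : \bar R) (f : T -> \bar R) : (0 <= c)%E ->
    (forall i, (0 <= f i)%E) ->
    (\esum_(i in [set: T]) (c * f i) <= c * \esum_(i in [set: T]) f i)%E.
  move=> c0 f0; apply: ge_ereal_sup => _ [X [finX _] <-].
  rewrite -ge0_mule_fsumr// lee_wpmul2l// ereal_sup_ubound//.
  by exists X.
move=> k0 a0; apply/eqP; rewrite eq_le le//=.
have ka0 i : (0 <= k * a i)%E by exact: mule_ge0.
case: k k0 ka0 => [r||//] k0 ka0.
- have [->|r0] := eqVneq r 0.
    by rewrite mul0e esum_ge0// => i _; rewrite mul0e.
  rewrite lee_fin in k0.
  have rV0 : (0 <= (r^-1)%:E :> \bar R)%E by rewrite lee_fin invr_ge0.
  have := le _ _ rV0 ka0.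
  under eq_esum do rewrite muleA -EFinM mulVf// mul1e.
  by rewrite -(@lee_pmul2l _ r%:E) ?lte_fin ?lt_def ?r0 ?k0//
    muleA -EFinM divff// mul1e.
(* With the factor [+oo], either all terms vanish and [+oo * 0 = 0], or a single positive term makes
   the sum infinite. *)
- have [/= a00|/existsNP[i ai]] := pselect (forall i, a i = 0%E).
    by rewrite [X in (_ * X)%E]esum1// mule0 esum_ge0.
  suff -> : (\esum_(j in [set: T]) (+oo * a j) = +oo)%E by rewrite leey.
  apply/eqP; rewrite -leye_eq.
  apply: (@le_trans _ _ (\esum_(j in [set i]) (+oo * a j))%E).
    by rewrite esum_set1// gt0_mulye// lt_neqAle a0 andbT eq_sym; apply/eqP.
  rewrite esum_mkcond; apply: le_esum => j _.
  by case: ifPn => // _; exact: ka0.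
Qed.

Lemma esum_mulM (R : realType) (T U : choiceType) (a : T -> \bar R)
    (b : U -> \bar R) :
  (forall i, (0 <= a i)%E) -> (forall j, (0 <= b j)%E) ->
  ((\esum_(i in [set: T]) a i) * (\esum_(j in [set: U]) b j) =
   \esum_(k in [set: T * U]) (a k.1 * b k.2))%E.
Proof.
move=> a0 b0; rewrite muleC -ge0_esumZl//; last exact: esum_ge0.
under eq_esum do rewrite muleC -ge0_esumZl//.
rewrite (esum_esum (J := fun=> setT)); last by move=> i j _ _; exact: mule_ge0.
by congr (esum _ _); apply/seteqP; split.
Qed.

(** Enumeration by [pickle], with 0 at the codes of no element, reduces countable sums to series
    over [nat], where monotone convergence and measurability of limits apply. *)
Lemma esum_countable (R : realType) (T : countType) (a : T -> \bar R) :
  (forall i, (0 <= a i)%E) ->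
  (\esum_(i in [set: T]) a i =
   \sum_(k <oo) oapp a 0 (pickle_inv k))%E.
Proof.
move=> a0; rewrite nneseries_esumT; last first.
  by move=> k; case: pickle_inv => //=.
rewrite (eq_esum (b := fun i => oapp a 0%E (pickle_inv (pickle i))));
  last first.
  by move=> i _; rewrite pickleK_inv.
rewrite -(esum_image setT pickle (fun k => oapp a 0%E (pickle_inv k)));
  last first.
  move=> i j _ _; exact: (pcan_inj pickleK_inv).
rewrite esum_mkcond; apply: eq_esum => k _; case: ifPn => // /negP kn.
have := pickle_invK k (T := T); case: (pickle_inv k) => //= i ki.
by case: kn; rewrite inE; exists i.
Qed.

Lemma ge0_integral_esum d (X : measurableType d) (R : realType)
    (mu : {measure set X -> \bar R}) (T : countType) (f : T -> X -> \bar R) :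
  (forall i, measurable_fun [set: X] (f i)) ->
  (forall i t, (0 <= f i t)%E) ->
  (\int[mu]_t (\esum_(i in [set: T]) f i t) =
   \esum_(i in [set: T]) \int[mu]_t f i t)%E.
Proof.
move=> mf f0.
rewrite esum_countable; last by move=> i; exact: integral_ge0.
under eq_integral do rewrite esum_countable//.
rewrite integral_nneseries//; first last.
- by move=> k t _; case: pickle_inv => /=.
- by move=> k; case: pickle_inv => [i|] /=; [exact: mf|exact: measurable_cst].
apply: eq_eseriesr => k _; case: pickle_inv => //=.
by rewrite integral0.
Qed.

Lemma measurable_fun_esum d (X : measurableType d) (R : realType)
    (T : countType) (f : T -> X -> \bar R) :
  (forall i, measurable_fun [set: X] (f i)) ->
  (forall i t, (0 <= f i t)%E) ->
  measurable_fun [set: X] (fun t => \esum_(i in [set: T]) f i t)%E.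
Proof.
move=> mf f0; under eq_fun do rewrite esum_countable//.
apply: (ge0_emeasurable_sum (P := predT)).
- by move=> k t _ _; case: pickle_inv => /=.
- by move=> k _; case: pickle_inv => [i|] /=; [exact: mf|exact: measurable_cst].
Qed.

(** * Quadratic forms, positive definiteness and rank-one updates *)

Definition bilin_form (R : realType) n (A : 'M[R]_n) (u w : 'cV[R]_n) : R :=
  (u^T *m A *m w) 0 0.

Section QuadForm.
Context (R : realType) (n : nat).
Implicit Types (A P S : 'M[R]_n) (u v w : 'cV[R]_n).

Lemma bilin_formC A u w : A^T = A -> bilin_form A u w = bilin_form A w u.
Proof.
move=> hA; have : (u^T *m A *m w)^T = w^T *m A *m u.
  by rewrite !trmx_mul trmxK hA mulmxA.
by rewrite /bilin_form => <-; rewrite [RHS]mxE.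
Qed.

Lemma bilin_formDl A u v w :
  bilin_form A (u + v) w = bilin_form A u w + bilin_form A v w.
Proof. by rewrite /bilin_form linearD/= !mulmxDl mxE. Qed.

Lemma bilin_formDr A u v w :
  bilin_form A w (u + v) = bilin_form A w u + bilin_form A w v.
Proof. by rewrite /bilin_form mulmxDr mxE. Qed.

Lemma bilin_formZl A k u w : bilin_form A (k *: u) w = k * bilin_form A u w.
Proof. by rewrite /bilin_form linearZ/= -!scalemxAl mxE. Qed.

Lemma bilin_formZr A k u w : bilin_form A u (k *: w) = k * bilin_form A u w.
Proof. by rewrite /bilin_form -!scalemxAr mxE. Qed.

Lemma quad_formD A u w : A^T = A ->
  quad_form A (u + w) = quad_form A u + bilin_form A u w *+ 2 + quad_form A w.
Proof.
move=> hA; rewrite -[LHS]/(bilin_form A (u + w) (u + w)).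
rewrite bilin_formDl !bilin_formDr (bilin_formC w u hA) mulr2n !addrA.
by [].
Qed.

Lemma quad_formZ A k u : quad_form A (k *: u) = k ^+ 2 * quad_form A u.
Proof.
by rewrite -[LHS]/(bilin_form A (k *: u) (k *: u)) bilin_formZl bilin_formZr
  mulrA.
Qed.

Lemma quad_formN A u : quad_form A (- u) = quad_form A u.
Proof. by rewrite -scaleN1r quad_formZ sqrrN expr1n mul1r. Qed.

Lemma quad_form_parallelogram A u w : A^T = A ->
  quad_form A (u + w) + quad_form A (u - w) =
  (quad_form A u + quad_form A w) *+ 2.
Proof.
move=> hA; rewrite !quad_formD// quad_formN -scaleN1r bilin_formZr; ring.
Qed.

Lemma quad_form_mulmx A (B : 'M[R]_n) u :
  quad_form A (B *m u) = quad_form (B^T *m A *m B) u.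
Proof. by rewrite /quad_form trmx_mul !mulmxA. Qed.

Lemma posdef_possemidef A : posdef A -> possemidef A.
Proof.
move=> [hA A0]; split=> // u; have [->|/A0/ltW//] := eqVneq u 0.
by rewrite /quad_form mulmx0 mxE.
Qed.

Lemma possemidef_cauchy_schwarz P u w : possemidef P ->
  bilin_form P u w ^+ 2 <= quad_form P u * quad_form P w.
Proof.
move=> [hP P0]; set f := bilin_form P u w; set k := quad_form P w.
have k0 : 0 <= k := P0 w; have q0 := P0 u.
have [/eqP k00|k00] := boolP (k == 0).
  have [->|f0] := eqVneq f 0; first by rewrite k00; lra.
  (* Here [quad_form P w = 0] and [f != 0]; the multiple of [w] is chosen so that the form would
     take the value -1. *)
  have := P0 (u + (- (quad_form P u + 1) / (f *+ 2)) *: w).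
  rewrite quad_formD// bilin_formZr quad_formZ -/f -/k k00.
  have -> : - (quad_form P u + 1) / (f *+ 2) * f *+ 2 = - (quad_form P u + 1).
    by field.
  lra.
have {k00}k0 : 0 < k by rewrite lt_def k00.
(* This is the minimizer [u - (f / k) *: w] on the line through [u] along [w], scaled by [k] to
   avoid a division. *)
have := P0 (k *: u + (- f) *: w).
rewrite quad_formD// bilin_formZl bilin_formZr !quad_formZ -/f -/k.
have -> : k ^+ 2 * quad_form P u + k * (- f * f) *+ 2 + (- f) ^+ 2 * k =
  k * (quad_form P u * k - f ^+ 2) by ring.
by rewrite pmulr_rge0// subr_ge0.
Qed.

Lemma unitmx_trivial_ker A : (forall u, A *m u = 0 -> u = 0) -> A \in unitmx.
Proof.
move=> inj; rewrite -unitmx_tr -row_free_unit -kermx_eq0.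
apply/eqP/row_matrixP => i; rewrite row0; apply: trmx_inj; rewrite trmx0.
apply: inj; apply: trmx_inj; rewrite trmx0 trmx_mul trmxK -row_mul mulmx_ker.
by rewrite row0.
Qed.

Lemma posdef_unitmx A : posdef A -> A \in unitmx.
Proof.
move=> [_ A0]; apply: unitmx_trivial_ker => u Au0; apply/eqP.
apply: contraT => /A0; rewrite /quad_form -mulmxA Au0 mulmx0 mxE ltxx.
by [].
Qed.

Lemma posdef_invmx A : posdef A -> posdef (invmx A).
Proof.
move=> pA; have uA := posdef_unitmx pA; case: pA => hA A0.
split=> [|u u0]; first by rewrite trmx_inv hA.
have -> : quad_form (invmx A) u = quad_form A (invmx A *m u).
  by rewrite quad_form_mulmx trmx_inv hA mulVmx// mul1mx.
apply: A0; apply: contra u0 => /eqP Au0.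
by rewrite -(mulKVmx uA u) Au0 mulmx0.
Qed.

Lemma quad_form_rank1 v u : quad_form (v *m v^T) u = ((u^T *m v) 0 0) ^+ 2.
Proof.
have -> : quad_form (v *m v^T) u = ((u^T *m v) *m (u^T *m v)^T) 0 0.
  by rewrite /quad_form trmx_mul trmxK !mulmxA.
by rewrite mxE big_ord1 [in X in _ * X]mxE expr2.
Qed.

Lemma posdef_rank1D S v : posdef S -> posdef (S + v *m v^T).
Proof.
move=> [hS S0]; split=> [|u u0]; first by rewrite linearD/= trmx_mul trmxK hS.
have -> : quad_form (S + v *m v^T) u = quad_form S u + quad_form (v *m v^T) u.
  by rewrite /quad_form mulmxDr mulmxDl mxE.
by rewrite quad_form_rank1 ltr_wpDr ?sqr_ge0 ?S0.
Qed.

(* Sherman-Morrison formula *)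
Lemma quad_form_invmx_rank1D S v u : posdef S ->
  quad_form (invmx (S + v *m v^T)) u =
  quad_form (invmx S) u -
    bilin_form (invmx S) u v ^+ 2 / (1 + quad_form (invmx S) v).
Proof.
move=> pS; have uS := posdef_unitmx pS.
have [hA A0] := posdef_possemidef (posdef_invmx pS).
have uS1 := posdef_unitmx (posdef_rank1D v pS).
set A := invmx S in hA A0 *; set k := 1 + quad_form A v.
have k0 : k != 0 by rewrite gt_eqF// /k; have := A0 v; lra.
pose X := A - k^-1 *: (A *m v *m (v^T *m A)).
have Wv : v^T *m A *m v = (k - 1)%:M.
  by rewrite [LHS]mx11_scalar -[X in X%:M]/(quad_form A v) /k addrC addKr.
have SA : (S + v *m v^T) *m A = 1%:M + v *m (v^T *m A).
  by rewrite mulmxDl mulmxV// mulmxA.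
have SX : (S + v *m v^T) *m X = 1%:M.
  rewrite /X mulmxBr -scalemxAr -[A *m v *m _]mulmxA [_ *m (A *m _)]mulmxA SA.
  rewrite [X in _ *: X]mulmxDl mul1mx -[v *m _ *m _]mulmxA.
  rewrite [_ *m (v *m _)]mulmxA Wv mul_scalar_mx.
  rewrite -scalemxAr -[X in X + (k - 1) *: _]scale1r -scalerDl scalerA.
  have -> : k^-1 * (1 + (k - 1)) = 1 by field.
  by rewrite scale1r addrK.
have <- : X = invmx (S + v *m v^T) by rewrite -[RHS]mulmx1 -SX mulKmx.
rewrite {1}/quad_form /X mulmxBr mulmxBl mxE [X in _ + X]mxE.
congr (_ - _).
rewrite -scalemxAr -scalemxAl mxE mulrC; congr (_ / _).
have -> : u^T *m (A *m v *m (v^T *m A)) *m u =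
    (u^T *m A *m v) *m (v^T *m A *m u) by rewrite !mulmxA.
by rewrite mxE big_ord1 expr2 -/(bilin_form A v u) (bilin_formC v u hA).
Qed.
End QuadForm.

(** * Theta series in integer coordinates and their convergence *)

(** [A] stands for the inverse of [S]. Integer coordinates make classes modulo 2L plain parities,
    and extended real values let sums be rearranged before convergence is known. *)
Definition theta (R : realType) (n : nat) (B A : 'M[R]_n) (x : 'cV[R]_n) :
    \bar R :=
  (\esum_(z in [set: 'cV[int]_n])
    (expR (- pi * quad_form A (B *m map_mx intr z + x)))%:E)%E.

Lemma geometric_nneseries_lty (R : realType) (q : R) : 0 < q -> q < 1 ->
  (\sum_(k <oo) (q ^+ k)%:E < +oo)%E.
Proof.
move=> q0 q1; apply: (@le_lt_trans _ _ (1 / (1 - q))%:E); last exact: ltry.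
apply: lime_le.
  by apply: is_cvg_nneseries => k _ _; rewrite lee_fin exprn_ge0// ltW.
apply: nearW => m; rewrite sumEFin lee_fin.
have := geometric_le_lim m (@ler01 R) q0.
rewrite ger0_norm ?(ltW q0)// => /(_ q1).
by rewrite seriesEnat /=; apply: le_trans; apply: ler_sum => i _; rewrite mul1r.
Qed.

Lemma esum_int_geometric_lty (R : realType) (q : R) : 0 < q -> q < 1 ->
  (\esum_(k in [set: int]) (q ^+ `|k|%N)%:E < +oo)%E.
Proof.
move=> q0 q1; have p0 (k : nat) : (0 <= (q ^+ k)%:E :> \bar R)%E.
  by rewrite lee_fin exprn_ge0// ltW.
rewrite (esumID [set Posz k | k in [set: nat]])//.
apply: lte_add_pinfty.
  rewrite setTI esum_image; last by move=> i j _ _ [].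
  by rewrite -nneseries_esumT//; exact: geometric_nneseries_lty.
have -> : [set: int] `&` ~` [set Posz k | k in [set: nat]] =
    [set Negz k | k in [set: nat]].
  apply/seteqP; split=> [[k [_ /(_ (ex_intro2 _ _ k I erefl))]//|k _]|].
    by exists k.
  by move=> _ [k _ <-]; split=> // -[].
rewrite esum_image; last by move=> i j _ _ [].
apply: le_lt_trans (geometric_nneseries_lty q0 q1).
rewrite nneseries_esumT//; apply: le_esum => k _ /=.
(* [Negz k] is [-(k + 1)], so its term has one more factor [q] than the term of [Posz k]. *)
by rewrite lee_fin exprS ler_piMl ?ltW// exprn_gt0.
Qed.

(** Induction on the height: splitting off the top entry of a column factors the sum by
    [esum_mulM]. *)
Lemma esum_colint_prod (R : realType) n (g : 'I_n -> int -> R) :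
  (forall i k, 0 <= g i k) ->
  (forall i, \esum_(k in [set: int]) (g i k)%:E < +oo)%E ->
  (\esum_(z in [set: 'cV[int]_n]) (\prod_i g i (z i 0))%:E < +oo)%E.
Proof.
elim: n g => [|n IH] g g0 gy.
  rewrite (_ : [set: 'cV[int]_0] = [set 0]); last first.
    by apply/seteqP; split=> // z _; apply/matrixP => -[].
  by rewrite esum_set1 ?big_ord0 ?ltry// lee_fin.
pose e (p : int * 'cV[int]_n) : 'cV[int]_n.+1 :=
  \col_i oapp (fun j => p.2 j 0) p.1 (unlift 0 i).
rewrite (reindex_esum setT setT e); last first.
  rewrite setTT_bijective.
  exists (fun z : 'cV[int]_n.+1 =>
    (z 0 0, \col_j z (lift 0 j) 0) : int * 'cV[int]_n) => [[k z]|z].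

    congr (_, _); first by rewrite mxE unlift_none.
    by apply/matrixP => j l; rewrite !mxE liftK/= ord1.
  apply/matrixP => i l; rewrite mxE ord1 /=.
  by case: unliftP => [j ->|->]/=; rewrite ?mxE.
rewrite (eq_esum (b := fun p : int * 'cV[int]_n => (g 0 p.1)%:E *
    (\prod_(i < n) g (lift 0 i) (p.2 i 0))%:E)%E); last first.
  move=> p _; rewrite -EFinM big_ord_recl mxE unlift_none/=.
  by congr (_ * _)%:E; apply: eq_bigr => i _; rewrite mxE liftK.
rewrite -(esum_mulM (a := fun k => (g 0 k)%:E) (b := fun z : 'cV[int]_n =>
   (\prod_(i < n) g (lift 0 i) (z i 0))%:E)); first last.
- by move=> z; rewrite lee_fin prodr_ge0.
- by move=> k; rewrite lee_fin.
apply: lte_mul_pinfty.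
- by apply: esum_ge0 => k _; rewrite lee_fin.
- by rewrite ge0_fin_numE ?gy// esum_ge0// => k _; rewrite lee_fin.
- apply: (IH (fun i => g (lift 0 i))) => [i k|i]; [exact: g0|exact: gy].
Qed.

(** Lets Gaussian decay in an integer be bounded by geometric decay in its absolute value. *)
Lemma absz_le_sqr (R : realDomainType) (k : int) :
  (absz k)%:R <= k%:~R ^+ 2 :> R.
Proof.
have -> : k%:~R ^+ 2 = (absz k ^ 2)%N%:R :> R.
  by rewrite -rmorphXn -[RHS]/((Posz _)%:~R); congr (_%:~R); lia.
by rewrite ler_nat; nia.
Qed.

Section Theta.
Context (R : realType) (n : nat) (B : 'M[R]_n).
Implicit Types (A S : 'M[R]_n) (x : 'cV[R]_n).

Lemma theta_gt0 A x : (0 < theta B A x)%E.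
Proof.
rewrite /theta; apply: (@lt_le_trans _ _ (\esum_(z in [set 0%R : 'cV[int]_n])
    (expR (- pi * quad_form A (B *m map_mx intr z + x)))%:E)%E).
  by rewrite esum_set1 ?lte_fin ?lee_fin ?expR_gt0 ?expR_ge0.
rewrite esum_mkcond; apply: le_esum => z _.
by case: ifPn => // _; rewrite lee_fin expR_ge0.
Qed.

(* Cauchy-Schwarz bounds every coordinate of [y = B z + x] in the basis [B] by
   the quadratic form, which dominates the theta series by a product of
   geometric series over [int]. *)
Lemma theta_lty A x : B \in unitmx -> posdef A -> (theta B A x < +oo)%E.
Proof.
move=> uB pA; have uA := posdef_unitmx pA.
have [hA A0] := posdef_possemidef pA.
pose w i : 'cV[R]_n := invmx A *m (row i (invmx B))^T.
(* The sum dominates every [quad_form A (w i)] at once, and the summand 1 keeps [K] positive. *)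
pose K := 1 + \sum_i quad_form A (w i).
have K0 : 0 < K by rewrite ltr_pwDl// sumr_ge0.
have coord i u : ((invmx B *m u) i 0) ^+ 2 <= K * quad_form A u.
  have -> : (invmx B *m u) i 0 = bilin_form A u (w i).
    rewrite bilin_formC// /bilin_form /w trmx_mul trmxK trmx_inv hA mulmxKV//.
    by rewrite -row_mul [RHS]mxE.
  apply: (le_trans (possemidef_cauchy_schwarz u (w i) (conj hA A0))).
  rewrite mulrC ler_wpM2r// /K (bigD1 i)//= addrCA lerDl addr_ge0//.
  by rewrite sumr_ge0.
(* Adding the [n] coordinate bounds will cost a factor [n / n.+1 <= 1]; the successor keeps [c]
   positive when [n = 0]. *)
pose c := pi / (K * n.+1%:R).
have c0 : 0 < c by rewrite divr_gt0 ?pi_gt0// mulr_gt0.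
pose y := invmx B *m x; pose q := expR (- (c / 2)).
have q1 : q < 1 by rewrite /q -[ltRHS]expR0 ltr_expR oppr_lt0 divr_gt0.
pose g i k := expR (c * y i 0 ^+ 2) * q ^+ `|k : int|%N.
apply: (@le_lt_trans _ _
    (\esum_(z in [set: 'cV[int]_n]) (\prod_i g i (z i 0))%:E)%E); last first.
  apply: esum_colint_prod => [i k|i].
    by rewrite mulr_ge0 ?exprn_ge0 ?expR_ge0.
  under eq_esum do rewrite EFinM.
  rewrite ge0_esumZl ?lee_fin ?expR_ge0//; last first.
    by move=> k; rewrite lee_fin exprn_ge0 ?expR_ge0.
  apply: lte_mul_pinfty; rewrite ?lee_fin ?expR_ge0//.
  by apply: esum_int_geometric_lty; rewrite // expR_gt0.
apply: le_esum => z _; rewrite lee_fin.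
set u := B *m _ + x.
have gE i : g i (z i 0) = expR (c * y i 0 ^+ 2 - c / 2 * (absz (z i 0))%:R).
  by rewrite /g /q -expRM_natr -expRD; congr expR; ring.
under eq_bigr do rewrite gE.
rewrite -expR_sum ler_expR mulNr lerNl -sumrN.
have ui i : (invmx B *m u) i 0 = (z i 0)%:~R + y i 0.
  by rewrite /u mulmxDr mulKmx// mxE mxE.
apply: (@le_trans _ _ (\sum_i c * ((invmx B *m u) i 0) ^+ 2)).
  apply: ler_sum => i _; rewrite ui.
  have zz := absz_le_sqr R (z i 0).
  set a : R := (z i 0)%:~R in zz *; set t := y i 0.
  (* The bound comes from [(a + t)^2 = a^2 / 2 - t^2 + (a + 2 t)^2 / 2] together with [zz]. *)
  have := sqr_ge0 (a + 2 * t); have := mulr_ge0 (ltW c0) (sqr_ge0 (a + 2 * t)).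
  nra.
apply: (@le_trans _ _ (\sum_(i < n) c * (K * quad_form A u))).
  by apply: ler_sum => i _; rewrite ler_pM2l.
rewrite sumr_const card_ord -mulr_natr.
have -> : c * (K * quad_form A u) * n%:R =
    pi * quad_form A u * (n%:R / n.+1%:R).
  by rewrite /c; field; rewrite (gt_eqF K0) nat1r pnatr_eq0.
rewrite ler_piMr ?mulr_ge0 ?pi_ge0//.
by rewrite ler_pdivrMr// mul1r ler_nat.
Qed.

End Theta.

(** * The product formula for theta series and the inequality drawn from it *)

Lemma mule_add_le_sqr (R : realDomainType) (a b : \bar R) :
  (0 <= a -> 0 <= b -> a * b + a * b <= a * a + b * b)%E.
Proof.
case: a b => [a||] [b||]//= a0 b0.
- by rewrite -!EFinM -!EFinD lee_fin; have := sqr_ge0 (a - b); lra.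
- by rewrite mulyy addey ?leey.
- by rewrite [X in (_ <= X + _)%E]mulyy addye ?leey.
Qed.

Lemma esum_mule_add_le_sqr (R : realType) (T : choiceType) (f g : T -> \bar R) :
  (forall c, (0 <= f c)%E) -> (forall c, (0 <= g c)%E) ->
  (\esum_(c in [set: T]) (f c * g c) + \esum_(c in [set: T]) (f c * g c) <=
   \esum_(c in [set: T]) (f c * f c) + \esum_(c in [set: T]) (g c * g c))%E.
Proof.
move=> f0 g0; rewrite -!esumD; do ?by move=> c _; exact: mule_ge0.
by apply: le_esum => c _; exact: mule_add_le_sqr.
Qed.

Section ThetaMul.
Context (R : realType) (n : nat) (B : 'M[R]_n).
Implicit Types (A : 'M[R]_n) (x y t : 'cV[R]_n) (c : 'cV[bool]_n).

Definition int_parity c : 'cV[int]_n := map_mx (fun b : bool => Posz b) c.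

(** The function h_c: [w + w + int_parity c] runs through the integer vectors congruent to [c]
    modulo 2, and [pi / 2] absorbs the factor 2 of the parallelogram law. *)
Definition half_theta A c x : \bar R :=
  (\esum_(w in [set: 'cV[int]_n])
    (expR (- (pi / 2) *
       quad_form A (B *m map_mx intr (w + w + int_parity c) + x)))%:E)%E.

Lemma half_theta_ge0 A c x : (0 <= half_theta A c x)%E.
Proof. by apply: esum_ge0 => w _; rewrite lee_fin expR_ge0. Qed.

(** The entries of the image pair [(a, b)] satisfy [a + b = 2 u + c] and [u - b = v], so division of
    [a + b] by 2 recovers [u] as quotient and [c] as remainder. *)
Lemma sum_diff_bij :
  set_bij [set: 'cV[bool]_n * ('cV[int]_n * 'cV[int]_n)]
    [set: 'cV[int]_n * 'cV[int]_n]
    (fun p => (p.2.1 + p.2.2 + int_parity p.1, p.2.1 - p.2.2)).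
Proof.
rewrite setTT_bijective.
pose w (p : 'cV[int]_n * 'cV[int]_n) : 'cV[int]_n :=
  \col_i divz (p.1 i 0 + p.2 i 0) 2.
exists (fun p : 'cV[int]_n * 'cV[int]_n =>
  (\col_i (modz (p.1 i 0 + p.2 i 0) 2 != 0), (w p, w p - p.2))).
  move=> [c [u v]] /=.
  have wE : w (u + v + int_parity c, u - v) = u.
    by apply/matrixP => i j; rewrite !mxE ord1; case: (c i 0) => /=; lia.
  congr (_, (_, _)); rewrite ?wE ?subKr//.
  by apply/matrixP => i j; rewrite !mxE /= ord1; case: (c i 0) => /=; lia.
move=> [u v] /=; congr (_, _); last by rewrite opprB addrC subrK.
apply/matrixP => i j; rewrite !mxE /= ord1.
by case: eqP => /=; lia.
Qed.

(* Rotating the lattice [L * L] by 45 degrees: the pairs [(u + v, u - v)] are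
   the pairs congruent modulo [2 L]. *)
Lemma thetaM A x y : A^T = A ->
  (theta B A x * theta B A y =
   \esum_(c in [set: 'cV[bool]_n])
     (half_theta A c (x + y) * half_theta A c (x - y)))%E.
Proof.
move=> hA; have e0 (r : R) : (0 <= (expR r)%:E)%E by rewrite lee_fin expR_ge0.
rewrite /theta esum_mulM// (reindex_esum _ _ _ _ sum_diff_bij).
under [RHS]eq_esum do rewrite /half_theta esum_mulM//.
rewrite esum_esum; last by move=> *; rewrite mule_ge0.
rewrite (_ : _ `*`` _ = setT); last by apply/seteqP; split.
apply: eq_esum => -[c [w w']] _ /=.
rewrite -!EFinM -!expRD; congr (expR _)%:E.
set p := B *m _ + x; set q := B *m _ + y.
have hpq : B *m map_mx intr (w + w + int_parity c) + (x + y) = p + q.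
  rewrite /p /q addrACA -mulmxDr -map_mxD; congr (_ *m map_mx _ _ + _).
  by apply/matrixP => i j; rewrite !mxE /=; ring.
have hpmq : B *m map_mx intr (w' + w' + int_parity c) + (x - y) = p - q.
  rewrite /p /q opprD addrACA -mulmxBr -map_mxB; congr (_ *m map_mx _ _ + _).
  by apply/matrixP => i j; rewrite !mxE /=; ring.
rewrite hpq hpmq -[RHS]mulrDr quad_form_parallelogram//.
by field.
Qed.

Lemma theta_parallelogram A x t : A^T = A ->
  (theta B A x * theta B A t + theta B A x * theta B A t <=
   theta B A 0 * (theta B A (x + t) + theta B A (x - t)))%E.
Proof.
move=> hA; have h0 := half_theta_ge0.
(* With second argument 0 the two factors in [thetaM] coincide, which gives the squares needed on
   the right. *)
have sq y : (theta B A 0 * theta B A y =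
    \esum_(c in [set: 'cV[bool]_n]) (half_theta A c y * half_theta A c y))%E.
  rewrite (muleC (theta B A 0)) (thetaM y 0 hA); apply: eq_esum => c _.
  by rewrite addr0 subr0.
have main := esum_mule_add_le_sqr (h0 A ^~ (x + t)) (h0 A ^~ (x - t)).
(* Abstracting the theta values keeps unification from comparing their
   arguments. *)
have abstract_le (a b e f g p q r : \bar R) :
    (a * b = p -> e * f = q -> e * g = r -> 0 <= f ->
     0 <= g -> p + p <= q + r -> a * b + a * b <= e * (f + g))%E.
  by move=> -> <- <- ? ?; rewrite ge0_muleDr.
exact: (abstract_le _ _ _ _ _ _ _ _ (thetaM x t hA) (sq (x + t)) (sq (x - t))
  (ltW (theta_gt0 _ _ _)) (ltW (theta_gt0 _ _ _)) main).
Qed.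

End ThetaMul.

(** * Gaussian averages along a line and rank-one growth of [S] *)

(** The value is independent of the mean [m], which will vary with the lattice point while the
    deviation stays fixed. *)
Lemma integral_normal_fun (R : realType) (m s : R) : s != 0 ->
  (\int[lebesgue_measure]_x (normal_fun m s x)%:E = (normal_peak s)^-1%:E)%E.
Proof.
move=> s0; have p0 := normal_peak_gt0 s0.
rewrite -[RHS]mule1 -(integral_normal_pdf m s) -ge0_integralZl_EFin//.
- apply: eq_integral => x _; rewrite -EFinM normal_pdfE// mulKf//.
  by rewrite gt_eqF.
- by move=> x _; rewrite lee_fin normal_pdf_ge0.
- by apply/measurable_EFinP; exact: measurable_normal_pdf.
- by rewrite invr_ge0 ltW.
Qed.

(** Integrates a pointwise inequality against the weight [w]. The integrals enter through equations
    so that their closed forms can be supplied directly. *)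
Lemma le_integral_comb d (X : measurableType d) (R : realType)
    (mu : {measure set X -> \bar R}) (a b p q r : \bar R)
    (w F G H : X -> \bar R) :
  (0 <= a)%E -> (0 <= b)%E -> (forall s, (0 <= w s)%E) ->
  (forall s, (0 <= F s)%E) -> (forall s, (0 <= G s)%E) ->
  (forall s, (0 <= H s)%E) ->
  measurable_fun [set: X] (fun s => F s * w s)%E ->
  measurable_fun [set: X] (fun s => G s * w s)%E ->
  measurable_fun [set: X] (fun s => H s * w s)%E ->
  (\int[mu]_s (F s * w s) = p)%E -> (\int[mu]_s (G s * w s) = q)%E ->
  (\int[mu]_s (H s * w s) = r)%E ->
  (forall s, (a * H s + a * H s <= b * (F s + G s))%E) ->
  (a * r + a * r <= b * (p + q))%E.
Proof.
move=> a0 b0 w0 F0 G0 H0 mF mG mH <- <- <- le.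
have Fw s : (0 <= F s * w s)%E by exact: mule_ge0.
have Gw s : (0 <= G s * w s)%E by exact: mule_ge0.
have Hw s : (0 <= H s * w s)%E by exact: mule_ge0.
have mFG : measurable_fun [set: X] (fun s => F s * w s + G s * w s)%E.
  exact: emeasurable_funD.
have maH : measurable_fun [set: X] (fun s => a * (H s * w s))%E.
  by apply: emeasurable_funM => //; exact: measurable_cst.
have aH s : (0 <= a * (H s * w s))%E by rewrite mule_ge0.
have FGw s : (0 <= F s * w s + G s * w s)%E by rewrite adde_ge0.
rewrite -(ge0_integralZl mu measurableT)//.
rewrite -(ge0_integralD mu measurableT)// -(ge0_integralD mu measurableT)//.
rewrite -(ge0_integralZl mu measurableT)//.
apply: (ge0_le_integral mu measurableT).
- by move=> s _; rewrite adde_ge0.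
- exact: emeasurable_funD.
- by apply: emeasurable_funM => //; exact: measurable_cst.
move=> s _; rewrite -(ge0_muleDl _ (F0 s) (G0 s)) !muleA.
have aHs : (0 <= a * H s)%E by rewrite mule_ge0.
by rewrite -(ge0_muleDl _ aHs aHs) lee_wpmul2r.
Qed.

(** Descends to real numbers by finiteness, then cancels the Gaussian constant [k] and the factor
    2. *)
Lemma le_fine_cancel (R : realType) (k : R) (a b c d : \bar R) : 0 < k ->
  a \is a fin_num -> b \is a fin_num -> c \is a fin_num -> d \is a fin_num ->
  (a * (k%:E * d) + a * (k%:E * d) <= b * (k%:E * c + k%:E * c))%E ->
  fine a * fine d <= fine b * fine c.
Proof.
case: a b c d => [a||] [b||] [c||] [d||]// k0 _ _ _ _.
rewrite -?EFinM -?EFinD -?EFinM -?EFinD lee_fin /= => le.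
rewrite -(ler_pM2l k0); lra.
Qed.

Section RankOne.
Context (R : realType) (n : nat).
Implicit Types (B S : 'M[R]_n) (u v x : 'cV[R]_n).

Let mu := @lebesgue_measure R.

(** The standard deviation in [s] left by completing the square in [quad_form (invmx S) (u + s *: v)
    + s ^+ 2]. *)
Definition line_std S v : R :=
  Num.sqrt (2 * pi * (1 + quad_form (invmx S) v))^-1.

Lemma line_std_gt0 S v : posdef S -> 0 < line_std S v.
Proof.
move=> pS; have [_ A0] := posdef_possemidef (posdef_invmx pS).
by rewrite sqrtr_gt0 invr_gt0 !mulr_gt0 ?pi_gt0// ltr_pwDl.
Qed.

Lemma line_stdN S v : line_std S (- v) = line_std S v.
Proof. by rewrite /line_std quad_formN. Qed.

(** Completing the square in [s] leaves a remainder free of [s], which is the form of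
    [invmx (S + v *m v^T)] by Sherman-Morrison. *)
Lemma gaussian_line S v u (s : R) : posdef S ->
  expR (- pi * quad_form (invmx S) (u + s *: v)) * expR (- pi * s ^+ 2) =
  expR (- pi * quad_form (invmx (S + v *m v^T)) u) *
  normal_fun (- (bilin_form (invmx S) u v / (1 + quad_form (invmx S) v)))
    (line_std S v) s.
Proof.
move=> pS; have [hA A0] := posdef_possemidef (posdef_invmx pS).
rewrite quad_form_invmx_rank1D// /normal_fun -!expRD quad_formD// bilin_formZr.
rewrite quad_formZ.
have k0 : 0 < 1 + quad_form (invmx S) v by rewrite ltr_pwDl.
have -> : line_std S v ^+ 2 = (2 * pi * (1 + quad_form (invmx S) v))^-1.
  by rewrite sqr_sqrtr// invr_ge0 !mulr_ge0 ?pi_ge0// ltW.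
congr expR; have := pi_gt0 R; move: (pi) => p p0; field.
by rewrite !gt_eqF.
Qed.

(** One theta term times the weight, after completing the square: only the [normal_fun] factor
    depends on [s]. *)
Definition line_term B S v x (z : 'cV[int]_n) (s : R) : \bar R :=
  ((expR (- pi * quad_form (invmx (S + v *m v^T)) (B *m map_mx intr z + x)))%:E
   * (normal_fun (- (bilin_form (invmx S) (B *m map_mx intr z + x) v /
       (1 + quad_form (invmx S) v))) (line_std S v) s)%:E)%E.

Lemma line_term_ge0 B S v x z s : (0 <= line_term B S v x z s)%E.
Proof. by rewrite mule_ge0// lee_fin ?expR_ge0 ?normal_fun_ge0. Qed.

Lemma measurable_line_term B S v x z :
  measurable_fun [set: R] (line_term B S v x z).
Proof.
apply: emeasurable_funM; first exact: measurable_cst.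
by apply/measurable_EFinP; exact: measurable_normal_fun.
Qed.

Lemma esum_line_term B S v x s : posdef S ->
  (theta B (invmx S) (x + s *: v) * (expR (- pi * s ^+ 2))%:E =
   \esum_(z in [set: 'cV[int]_n]) line_term B S v x z s)%E.
Proof.
move=> pS; rewrite muleC -ge0_esumZl ?lee_fin ?expR_ge0//.
apply: eq_esum => z _; rewrite muleC -EFinM addrA gaussian_line//.
Qed.

Lemma measurable_theta_line B S v x : posdef S ->
  measurable_fun [set: R] (fun s => theta B (invmx S) (x + s *: v)
     * (expR (- pi * s ^+ 2))%:E)%E.
Proof.
move=> pS; under eq_fun do rewrite esum_line_term//.
apply: measurable_fun_esum => [z|z s]; first exact: measurable_line_term.
exact: line_term_ge0.
Qed.

(** Smoothing a Gaussian along [v] adds [v *m v^T] to [S]. The sum and the integral are exchanged by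
    nonnegativity, and every term yields the same constant. *)
Lemma integral_theta_line B S v x : posdef S ->
  (\int[mu]_s (theta B (invmx S) (x + s *: v)
     * (expR (- pi * s ^+ 2))%:E) =
   (normal_peak (line_std S v))^-1%:E *
     theta B (invmx (S + v *m v^T)) x)%E.
Proof.
move=> pS; have s0 := lt0r_neq0 (line_std_gt0 v pS).
under eq_integral do rewrite esum_line_term//.
rewrite ge0_integral_esum; first last.
- by move=> z s; exact: line_term_ge0.
- by move=> z; exact: measurable_line_term.
rewrite -ge0_esumZl; first last.
- by move=> z; rewrite lee_fin expR_ge0.
- by rewrite lee_fin invr_ge0 normal_peak_ge0.
apply: eq_esum => z _; rewrite ge0_integralZl_EFin ?expR_ge0//.
- by rewrite integral_normal_fun// muleC.
- by move=> s _; rewrite lee_fin expR_ge0.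
- by apply/measurable_EFinP; exact: measurable_normal_fun.
Qed.

Lemma theta_fin_num B S x : B \in unitmx -> posdef S ->
  theta B (invmx S) x \is a fin_num.
Proof.
move=> uB pS; rewrite ge0_fin_numE; last exact/ltW/theta_gt0.
by apply: theta_lty => //; exact: posdef_invmx.
Qed.

Lemma theta_ratio_rank1 B S v x : B \in unitmx -> posdef S ->
  fine (theta B (invmx S) x) * fine (theta B (invmx (S + v *m v^T)) 0) <=
  fine (theta B (invmx S) 0) * fine (theta B (invmx (S + v *m v^T)) x).
Proof.
move=> uB pS; have pS1 := posdef_rank1D v pS.
have [hA _] := posdef_invmx pS.
have t0 y : (0 <= theta B (invmx S) y)%E by exact/ltW/theta_gt0.
(* The symmetry in [s] is obtained by averaging along [- v], which gives the same rank-one matrix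
   and the same deviation, instead of by a change of variable. *)
have vvN : (- v) *m (- v)^T = v *m v^T by rewrite linearN/= mulNmx mulmxN opprK.
have intN := integral_theta_line B (- v) x pS.
rewrite vvN line_stdN in intN.
have par s : (theta B (invmx S) x * theta B (invmx S) (0 + s *: v) +
    theta B (invmx S) x * theta B (invmx S) (0 + s *: v) <=
    theta B (invmx S) 0 * (theta B (invmx S) (x + s *: v) +
      theta B (invmx S) (x + s *: - v)))%E.
  by rewrite add0r scalerN; exact: theta_parallelogram.
have C0 : 0 < (normal_peak (line_std S v))^-1.
  by rewrite invr_gt0 normal_peak_gt0// gt_eqF// line_std_gt0.
apply: (le_fine_cancel C0 (theta_fin_num x uB pS) (theta_fin_num 0 uB pS)
  (theta_fin_num x uB pS1) (theta_fin_num 0 uB pS1)).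
have w0 s : (0 <= (expR (- pi * s ^+ 2))%:E :> \bar R)%E.
  by rewrite lee_fin expR_ge0.
exact: (@le_integral_comb _ _ _ (@lebesgue_measure R) _ _ _ _ _ _ _ _ _
  (t0 x) (t0 0) w0
  (fun s => t0 _) (fun s => t0 _) (fun s => t0 _)
  (measurable_theta_line B v x pS) (measurable_theta_line B (- v) x pS)
  (measurable_theta_line B v 0 pS)
  (integral_theta_line B v x pS) intN (integral_theta_line B v 0 pS) par).
Qed.

End RankOne.

(** * Positive semidefinite increments by Cholesky elimination *)

Lemma le_quotients (R : realFieldType) (a b c d : R) :
  0 < b -> 0 < d -> a * d <= b * c -> a / b <= c / d.
Proof.
by move=> b0 d0 le; rewrite ler_pdivrMr// mulrAC ler_pdivlMr// [leRHS]mulrC.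
Qed.

Section PosSemiDef.
Context (R : realType) (n : nat).
Implicit Types (B P S : 'M[R]_n) (u v x : 'cV[R]_n).

Lemma bilin_form_delta P u i :
  bilin_form P u (delta_mx i 0) = (u^T *m col i P) 0 0.
Proof. by rewrite /bilin_form -mulmxA -colE. Qed.

Lemma quad_form_delta P i : quad_form P (delta_mx i 0) = P i i.
Proof.
by rewrite -[LHS]/(bilin_form _ _ _) bilin_form_delta trmx_delta -rowE !mxE.
Qed.

(** Cauchy-Schwarz on two basis vectors bounds the square of [P j i] by [P j j * P i i]. *)
Lemma possemidef_diag0 P i j : possemidef P -> P i i = 0 -> P j i = 0.
Proof.
move=> pP Pii.
have := possemidef_cauchy_schwarz (delta_mx j 0) (delta_mx i 0) pP.
rewrite !quad_form_delta Pii mulr0 bilin_form_delta trmx_delta -rowE !mxE.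
by move=> le; apply/eqP; rewrite -sqrf_eq0 eq_le le sqr_ge0.
Qed.

(* One step of Cholesky elimination: it kills the diagonal entry [P i i] and
   creates no new nonzero diagonal entry. *)
Lemma possemidef_eliminate P i : possemidef P -> P i i != 0 ->
  exists v, [/\ possemidef (P - v *m v^T), (P - v *m v^T) i i = 0 &
    forall j, P j j = 0 -> (P - v *m v^T) j j = 0].
Proof.
move=> pP Pii; have [hP P0] := pP.
have p0 : 0 < P i i by rewrite lt_def Pii -quad_form_delta P0.
pose a := (Num.sqrt (P i i))^-1.
have a2 : a ^+ 2 = (P i i)^-1 by rewrite exprVn sqr_sqrtr// ltW.
(* With this scaling [v *m v^T] agrees with [P] on row and column [i]; semidefiniteness of the
   difference is Cauchy-Schwarz against the basis vector of index [i]. *)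
pose v := a *: col i P.
have diag j : (P - v *m v^T) j j = P j j - (P j i) ^+ 2 / P i i.
  by rewrite !mxE big_ord1 !mxE -a2; ring.
exists v; split.
- split=> [|u]; first by rewrite linearB/= trmx_mul trmxK hP.
  have -> : quad_form (P - v *m v^T) u = quad_form P u - quad_form (v *m v^T) u.
    by rewrite /quad_form mulmxBr mulmxBl !mxE.
  rewrite quad_form_rank1 /v -scalemxAr mxE -bilin_form_delta exprMn a2.
  rewrite subr_ge0 mulrC ler_pdivrMr//.
  have := possemidef_cauchy_schwarz u (delta_mx i 0) pP.
  by rewrite quad_form_delta.
- by rewrite diag expr2 mulfK// subrr.
- move=> j Pjj; rewrite diag Pjj -hP mxE (possemidef_diag0 _ pP Pjj); ring.
Qed.

Definition theta_ratio B S x : R :=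
  fine (theta B (invmx S) x) / fine (theta B (invmx S) 0).

(** Induction on the number of nonzero diagonal entries of [P]: each elimination moves one rank-one
    piece from [P] into [S], and a zero diagonal forces [P = 0]. *)
Lemma le_theta_ratio B S P x : B \in unitmx -> posdef S -> possemidef P ->
  theta_ratio B S x <= theta_ratio B (S + P) x.
Proof.
move=> uB; have [m] := ubnP #|[pred i | P i i != 0]|.
elim: m => // m IH in P S * => cardP pS pP.
have [/existsP[i Pii]|/existsPn P0] := boolP [exists i, P i i != 0]; last first.
  have -> : P = 0; last by rewrite addr0.
  apply/matrixP => j i; rewrite (possemidef_diag0 _ pP) ?mxE//.
  by apply/eqP; move: (P0 i); rewrite negbK.
have [v [pP' P'ii P'jj]] := possemidef_eliminate pP Pii.
have pS1 := posdef_rank1D v pS.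
apply: (@le_trans _ _ (theta_ratio B (S + v *m v^T) x)).
  have fine_theta_gt0 T : posdef T -> 0 < fine (theta B (invmx T) 0).
    move=> pT; rewrite fine_gt0// theta_gt0 -ge0_fin_numE ?theta_fin_num//.
    by rewrite ltW ?theta_gt0.
  exact: (le_quotients (fine_theta_gt0 _ pS) (fine_theta_gt0 _ pS1)
    (theta_ratio_rank1 _ _ _ pS)).
have -> : S + P = S + v *m v^T + (P - v *m v^T).
  by rewrite [P - _]addrC addrA addrK.
(* The count drops strictly, since [i] leaves the set of nonzero diagonal entries and no index joins
   it. *)
apply: IH => //; rewrite -ltnS; apply: leq_trans cardP; rewrite ltnS.
apply: proper_card; apply/properP; split.
  by apply/fintype.subsetP => j; rewrite !inE; apply: contra_neq => /P'jj.
by exists i; rewrite !inE ?P'ii ?eqxx.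
Qed.

End PosSemiDef.

(** * Lattices as images of integer vectors under a basis matrix *)

Section Lattice.
Context (R : realType) (n : nat).

Definition lattice_mx (b : n.-tuple 'cV[R]_n) : 'M[R]_n :=
  \matrix_(i, j) tnth b j i 0.

Lemma lattice_mxE (b : n.-tuple 'cV[R]_n) (u : 'cV[R]_n) :
  lattice_mx b *m u = \sum_i u i 0 *: tnth b i.
Proof.
apply/matrixP => i j; rewrite ord1 mxE summxE; apply: eq_bigr => k _.
by rewrite !mxE mulrC.
Qed.

Lemma lattice_mx_unit (b : n.-tuple 'cV[R]_n) :
  free b -> lattice_mx b \in unitmx.
Proof.
move=> /freeP fb; apply: unitmx_trivial_ker => u.
rewrite lattice_mxE => bu; apply/matrixP => i j; rewrite ord1 mxE.
apply: (fb (fun i => u i 0)); apply: (etrans _ bu); apply: eq_bigr => k _.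
by rewrite (tnth_nth 0).
Qed.

(** Freeness makes the coordinate map injective, so each lattice point is counted exactly once. *)
Lemma gauss_massE (b : n.-tuple 'cV[R]_n) (S : 'M[R]_n) (x : 'cV[R]_n) :
  free b ->
  gauss_mass (lattice_of b) S x = fine (theta (lattice_mx b) (invmx S) x).
Proof.
move=> fb; pose e (z : 'cV[int]_n) := lattice_mx b *m map_mx intr z.
have -> : lattice_of b = [set e z | z in [set: 'cV[int]_n]].
  apply/seteqP; split=> [_ [z ->]|_ [z _ <-]].
    exists (\col_i z i) => //; rewrite /e lattice_mxE.
    by apply: eq_bigr => i _; rewrite !mxE scaler_int.
  exists (fun i => z i 0); rewrite /e lattice_mxE.
  by apply: eq_bigr => i _; rewrite !mxE scaler_int.
rewrite /gauss_mass esum_image// => z z' _ _.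
move=> /(congr1 (mulmx (invmx (lattice_mx b)))).
rewrite /e !mulKmx ?lattice_mx_unit// => /matrixP zz.
by apply/matrixP => i j; have := zz i j; rewrite !mxE => /intr_inj.
Qed.

End Lattice.

Theorem proposition4p2 (R : realType) (n : nat) (L : set 'cV[R]_n)
    (hL : is_lattice L) (x : 'cV[R]_n) (S S' : 'M[R]_n)
    (hS : posdef S) (hS' : posdef S') (hle : psd_le S' S) :
  periodic_gauss L S' x <= periodic_gauss L S x.
Proof.
have [b fb ->] := hL; rewrite /periodic_gauss !gauss_massE//.
have -> : S = S' + (S - S') by rewrite addrC subrK.
exact: le_theta_ratio (lattice_mx_unit fb) hS' hle.
Qed.
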